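(* Let $d\ge 1$ and $1\le p<q<\infty$. Then the Morrey space $\mathcal{M}^p_q(\mathbb{R}^d)$ satisfies $$C_{\rm NJ}(\mathcal{M}^p_q)=C_{\rm J}(\mathcal{M}^p_q)=2\quad\text{and}\quad C_{\rm DW}(\mathcal{M}^p_q)=4.$$
   Context: For $1\le p\le q<\infty$, the Morrey space $\mathcal{M}^p_q=\mathcal{M}^p_q(\mathbb{R}^d)$ is the Banach space of all measurable functions $f$ on $\mathbb{R}^d$ with $$\|f\|_{\mathcal{M}^p_q}:=\sup_{B=B(a,r)}|B|^{\frac1q-\frac1p}\Big(\int_B|f(y)|^p\,dy\Big)^{1/p}<\infty,$$ the supremum taken over all Euclidean balls $B(a,r)$ with center $a\in\mathbb{R}^d$ and radius $r>0$, and $|B|$ the Lebesgue measure of $B$ (functions equal a.e. identified). For a Banach space $X$: the von Neumann–Jordan constant is $C_{\rm NJ}(X):=\sup\Big\{\frac{\|x+y\|_X^2+\|x-y\|_X^2}{2(\|x\|_X^2+\|y\|_X^2)}: x,y\in X\setminus\{0\}\Big\}$; the James constant is $C_{\rm J}(X):=\sup\{\min\{\|x+y\|_X,\|x-y\|_X\}: x,y\in X,\ \|x\|_X=\|y\|_X=1\}$; the Dunkl–Williams constant is $C_{\rm DW}(X):=\sup\Big\{\frac{\|x\|_X+\|y\|_X}{\|x-y\|_X}\Big\|\frac{x}{\|x\|_X}-\frac{y}{\|y\|_X}\Big\|_X: x,y\in X,\ x\neq0,\ y\neq0,\ x\neq y\Big\}$. *)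

(* Defs.v *)
From HB Require Import structures.
From mathcomp Require Import all_boot all_order all_algebra.
From mathcomp Require Import all_classical all_reals all_analysis.
Set Implicit Arguments. Unset Strict Implicit. Unset Printing Implicit Defensive.
Import Order.TTheory GRing.Theory Num.Theory.
Local Open Scope classical_set_scope.
Local Open Scope ring_scope.

Section Morrey.
Variable R : realType.

(* Lebesgue integral of a nonnegative function on R^d = d.-tuple R,
   computed as the iterated one-dimensional Lebesgue integral
   (equal to the integral against d-dimensional Lebesgue measure for
   nonnegative Borel functions, by Tonelli). *)
Fixpoint leb_int (d : nat) : (d.-tuple R -> \bar R) -> \bar R :=
  match d return (d.-tuple R -> \bar R) -> \bar R with
  | 0 => fun F => F [tuple]
  | n.+1 => fun F =>
      (\int[@lebesgue_measure R]_(x in [set: R])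
         leb_int (fun t : n.-tuple R => F [tuple of x :: t]))%E
  end.

Definition eball (d : nat) (a : d.-tuple R) (r : R) : set (d.-tuple R) :=
  [set x | \sum_(i < d) (tnth x i - tnth a i) ^+ 2 < r ^+ 2].

Definition lvol (d : nat) (B : set (d.-tuple R)) : \bar R :=
  leb_int (fun x => (\1_B x)%:E).

Definition bint (d : nat) (p : R) (f : d.-tuple R -> R) (B : set (d.-tuple R))
  : \bar R := leb_int (fun x => (\1_B x * (`|f x| `^ p))%:E).

Definition morrey_enorm (d : nat) (p q : R) (f : d.-tuple R -> R) : \bar R :=
  ereal_sup [set v | exists (a : d.-tuple R) (r : R), 0 < r /\
     v = (poweR (lvol (eball a r)) (q^-1 - p^-1)
          * poweR (bint p f (eball a r)) p^-1)%E].

Definition morrey_norm (d : nat) (p q : R) (f : d.-tuple R -> R) : R :=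
  fine (morrey_enorm p q f).

(* The Morrey space M^p_q(R^d): measurable functions with finite norm
   (functions are identified a.e., i.e. modulo norm zero, below). *)
Definition Morrey (d : nat) (p q : R) : set (d.-tuple R -> R) :=
  [set f | measurable_fun [set: d.-tuple R] f /\
           (morrey_enorm p q f < +oo)%E].

(* Geometric constants of a (semi)normed space X with norm N; elements of
   norm zero are identified with 0 (quotient by the null space). *)
Definition C_NJ (T : Type) (X : set (T -> R)) (N : (T -> R) -> R) : \bar R :=
  ereal_sup [set v | exists x y, X x /\ X y /\ N x != 0 /\ N y != 0 /\
    v = (((N (x \+ y)) ^+ 2 + (N (x \- y)) ^+ 2)
          / (2 * ((N x) ^+ 2 + (N y) ^+ 2)))%:E].

Definition C_J (T : Type) (X : set (T -> R)) (N : (T -> R) -> R) : \bar R :=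
  ereal_sup [set v | exists x y, X x /\ X y /\ N x = 1 /\ N y = 1 /\
    v = (Num.min (N (x \+ y)) (N (x \- y)))%:E].

Definition C_DW (T : Type) (X : set (T -> R)) (N : (T -> R) -> R) : \bar R :=
  ereal_sup [set v | exists x y, X x /\ X y /\ N x != 0 /\ N y != 0 /\
    N (x \- y) != 0 /\
    v = ((N x + N y) / N (x \- y)
          * N ((fun t => x t / N x) \- (fun t => y t / N y)))%:E].

End Morrey.

(* Main.v *)
(* The upper bounds hold in every seminormed space.  For the lower bounds it
   suffices to embed the plane with the maximum norm isometrically.  For a unit
   ball E the function g = |E|^(-1/q) 1_E has Morrey norm 1.  Take a second unit
   ball F, far from E, with h = |F|^(-1/q) 1_F: a ball B meeting only one of E
   and F sees only one of g and h, and a ball meeting both is so large that, as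
   1/q - 1/p < 0, the factor |B|^(1/q - 1/p) makes its contribution at most 1.
   Hence g + h also has norm 1, and the norm of s g + t h is max(|s|, |t|). *)

Require Import Defs.
From HB Require Import structures.
From mathcomp Require Import all_boot all_order all_algebra.
From mathcomp Require Import all_classical all_reals all_analysis.
From mathcomp Require Import measurable_realfun ring lra.
Set Implicit Arguments.
Unset Strict Implicit.
Unset Printing Implicit Defensive.
Import Order.TTheory GRing.Theory Num.Theory.
Local Open Scope classical_set_scope.
Local Open Scope ring_scope.

(** * Iterated Lebesgue integrals of nonnegative functions, and volumes of cubes *)

Section IteratedIntegral.
Context {R : realType}.
Implicit Types (n : nat).

Lemma eq_leb_int n (F G : n.-tuple R -> \bar R) :
  F =1 G -> leb_int F = leb_int G.
Proof. by move=> /funext ->. Qed.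

Lemma leb_int_ge0 n (F : n.-tuple R -> \bar R) :
  (forall z, (0 <= F z)%E) -> (0 <= leb_int F)%E.
Proof.
elim: n F => [|n IHn] F F0 /=; first exact: F0.
by apply: integral_ge0 => x _; exact: IHn.
Qed.

(** The parameter space [T] is arbitrary because the induction moves the outermost integration
    variable into it: the inner integral is measurable on [T * R], and Tonelli then integrates that
    variable out. *)
Lemma measurable_fun_leb_int n d (T : measurableType d)
    (F : T * n.-tuple R -> \bar R) :
  measurable_fun [set: T * n.-tuple R] F -> (forall z, (0 <= F z)%E) ->
  measurable_fun [set: T] (fun x => leb_int (fun t => F (x, t))).
Proof.
elim: n => [|n IHn] in d T F * => mF F0 /=.
  exact: measurable_fun_pair1.
have mG : measurable_fun [set: (T * R) * n.-tuple R]
    (fun z => F (z.1.1, [tuple of z.1.2 :: z.2])).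
  apply: (measurableT_comp mF); apply: measurable_fun_pair.
    exact: (measurableT_comp measurable_fst measurable_fst).
  apply: measurable_cons; last exact: measurable_snd.
  exact: (measurableT_comp measurable_snd measurable_fst).
apply: (@measurable_fun_fubini_tonelli_F _ _ T _ R (@lebesgue_measure R)
  (fun z => leb_int (fun t : n.-tuple R => F (z.1, [tuple of z.2 :: t])))).
  exact: IHn mG _.
by move=> z; apply: leb_int_ge0.
Qed.

Lemma measurable_fun_cons_section n (F : n.+1.-tuple R -> \bar R) x :
  measurable_fun [set: n.+1.-tuple R] F ->
  measurable_fun [set: n.-tuple R] (fun t => F [tuple of x :: t]).
Proof. by move=> mF; apply: (measurableT_comp mF); exact: measurable_cons. Qed.

Lemma measurable_fun_leb_int_cons n (F : n.+1.-tuple R -> \bar R) :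
  measurable_fun [set: n.+1.-tuple R] F -> (forall z, (0 <= F z)%E) ->
  measurable_fun [set: R]
    (fun x => leb_int (fun t : n.-tuple R => F [tuple of x :: t])).
Proof.
move=> mF F0.
apply: (@measurable_fun_leb_int n _ _
  (fun z : R * n.-tuple R => F [tuple of z.1 :: z.2])) => //.
by apply: (measurableT_comp mF); exact: measurable_cons.
Qed.

Lemma le_leb_int n (F G : n.-tuple R -> \bar R) :
  measurable_fun [set: n.-tuple R] F -> measurable_fun [set: n.-tuple R] G ->
  (forall z, (0 <= F z)%E) -> (forall z, (F z <= G z)%E) ->
  (leb_int F <= leb_int G)%E.
Proof.
elim: n F G => [|n IHn] F G mF mG F0 FG /=; first exact: FG.
have G0 z : (0 <= G z)%E by rewrite (le_trans (F0 z)).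
apply: ge0_le_integral => //.
- by move=> x _; exact: leb_int_ge0.
- exact: measurable_fun_leb_int_cons.
- exact: measurable_fun_leb_int_cons.
- by move=> x _; apply: IHn => //; exact: measurable_fun_cons_section.
Qed.

Lemma leb_intD n (F G : n.-tuple R -> \bar R) :
  measurable_fun [set: n.-tuple R] F -> measurable_fun [set: n.-tuple R] G ->
  (forall z, (0 <= F z)%E) -> (forall z, (0 <= G z)%E) ->
  leb_int (fun z => F z + G z)%E = (leb_int F + leb_int G)%E.
Proof.
elim: n F G => [//|n IHn] F G mF mG F0 G0 /=.
rewrite -ge0_integralD//; first last.
- exact: measurable_fun_leb_int_cons.
- by move=> x _; exact: leb_int_ge0.
- exact: measurable_fun_leb_int_cons.
- by move=> x _; exact: leb_int_ge0.
apply: eq_integral => x _.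
by rewrite IHn//; exact: measurable_fun_cons_section.
Qed.

Lemma leb_intZl n (k : R) (F : n.-tuple R -> \bar R) :
  0 <= k -> measurable_fun [set: n.-tuple R] F -> (forall z, (0 <= F z)%E) ->
  leb_int (fun z => k%:E * F z)%E = (k%:E * leb_int F)%E.
Proof.
move=> k0; elim: n F => [//|n IHn] F mF F0 /=.
rewrite -ge0_integralZl_EFin//; first last.
- exact: measurable_fun_leb_int_cons.
- by move=> x _; exact: leb_int_ge0.
apply: eq_integral => x _.
by rewrite IHn//; exact: measurable_fun_cons_section.
Qed.

(** Open cubes serve as the computable substitute for balls: their indicators factor over the
    coordinates, so the iterated integral is explicit, and ball volumes are only estimated by
    inscribed and circumscribed cubes. *)
Definition box n (a : n.-tuple R) (r : R) : set (n.-tuple R) :=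
  [set x | forall i, `|tnth x i - tnth a i| < r].

Lemma measurable_box n (a : n.-tuple R) (r : R) : measurable (box a r).
Proof.
rewrite (_ : box a r = \bigcap_(i in [set: 'I_n])
    ((fun x => tnth x i) @^-1` `]tnth a i - r, tnth a i + r[)).
  apply: fin_bigcap_measurable => // i _.
  rewrite -[X in measurable X]setTI.
  by apply: measurable_tnth => //; exact: measurable_itv.
by apply/seteqP; split=> x /= h i => [_|]; have := h i;
  rewrite /= in_itv/= ltr_norml; lra.
Qed.

Lemma lvol_box n (a : n.-tuple R) (r : R) :
  0 < r -> lvol (box a r) = ((2 * r) ^+ n)%:E.
Proof.
move=> r0; rewrite /lvol; elim: n a => [|n IHn] a /=.
  by rewrite indicE mem_set// => -[].
case/tupleP: a => a0 a.
have boxS x (t : n.-tuple R) :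
    \1_(box [tuple of a0 :: a] r) [tuple of x :: t] =
    \1_(`]a0 - r, a0 + r[ : set R) x * \1_(box a r) t :> R.
  rewrite !indicE -natrM mulnb; congr (_%:R); congr nat_of_bool.
  apply/idP/idP => [/set_mem h|/andP[/set_mem h1 /set_mem h2]].
    apply/andP; split; apply/mem_set; last move=> i.
      rewrite /=; have := h ord0; rewrite !tnth0 in_itv/= ltr_norml; lra.
    by have := h (lift ord0 i); rewrite !tnthS.
  apply/mem_set => i; case: (unliftP ord0 i) => [j ->|->].
    by rewrite !tnthS; exact: h2.
  by rewrite !tnth0 ltr_norml; move: h1; rewrite /= in_itv/=; lra.
transitivity (\int[@lebesgue_measure R]_x
    (((2 * r) ^+ n)%:E * (\1_(`]a0 - r, a0 + r[ : set R) x)%:E))%E.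
  apply: eq_integral => x _.
  rewrite -(IHn a) muleC -leb_intZl//.
  - by apply: eq_leb_int => t; rewrite boxS EFinM.
  - by apply/measurable_EFinP; apply: measurable_indic; exact: measurable_box.
rewrite ge0_integralZl_EFin//.
- rewrite integral_indic// setIT.
  rewrite [X in (_ * X)%E]lebesgue_measure_itv/= lte_fin.
  rewrite ifT; last lra.
  by rewrite -EFinD -EFinM; congr (_%:E); rewrite exprS; ring.
- by apply/measurable_EFinP; exact: measurable_indic.
- by rewrite exprn_ge0//; lra.
Qed.

End IteratedIntegral.

(** * Two-sided bounds for the volume of Euclidean balls *)

Section BallVolume.
Context {R : realType} {d : nat}.
Implicit Types (a : d.-tuple R) (r : R).

Lemma measurable_eball a r : measurable (eball a r).
Proof.
have mf : measurable_fun [set: d.-tuple R]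
    (fun x => \sum_(i < d) (tnth x i - tnth a i) ^+ 2).
  apply: measurable_sum => i.
  apply: measurable_funX; apply: measurable_funB => //.
  exact: measurable_tnth.
rewrite -[X in measurable X]setTI.
have -> : eball a r = (fun x => \sum_(i < d) (tnth x i - tnth a i) ^+ 2)
    @^-1` `]-oo, r ^+ 2[.
  by apply/seteqP; split=> x /=; rewrite in_itv.
exact: mf.
Qed.

Lemma le_lvol (A B : set (d.-tuple R)) :
  measurable A -> measurable B -> A `<=` B -> (lvol A <= lvol B)%E.
Proof.
move=> mA mB AB; apply: le_leb_int.
- by apply/measurable_EFinP; exact: measurable_indic.
- by apply/measurable_EFinP; exact: measurable_indic.
- by move=> z; rewrite lee_fin.
- move=> z; rewrite lee_fin !indicE ler_nat.
  by case: (boolP (z \in A)) => // /set_mem/AB/mem_set ->.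
Qed.

Lemma eball_tnth a r x i : 0 < r -> eball a r x -> `|tnth x i - tnth a i| < r.
Proof.
move=> r0 /= xr; rewrite -ltr_sqr ?nnegrE//; last exact: ltW.
rewrite real_normK ?num_real//; apply: le_lt_trans xr.
by rewrite (bigD1 i)//= lerDl sumr_ge0// => j _; exact: sqr_ge0.
Qed.

Hypothesis d_gt0 : (0 < d)%N.

(** The half side [r / d] avoids square roots: [d] squares, each below [(r / d) ^ 2], add up to less
    than [r ^ 2 / d], which is at most [r ^ 2]. *)
Lemma box_sub_eball a r : 0 < r -> box a (r / d%:R) `<=` eball a r.
Proof.
move=> r0 x /= h.
have d0 : 0 < d%:R :> R by rewrite ltr0n.
have d1 : 1 <= d%:R :> R by rewrite ler1n.
apply: (@lt_le_trans _ _ (\sum_(i < d) (r / d%:R) ^+ 2)).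
  apply: ltr_sum => [|i _]; first by apply/hasP; exists (Ordinal d_gt0).
  by rewrite -real_normK ?num_real// ltr_sqr ?nnegrE// divr_ge0// ltW.
rewrite sumr_const card_ord -[X in X <= _]mulr_natr.
rewrite (_ : (r / d%:R) ^+ 2 * d%:R = r ^+ 2 / d%:R); last first.
  by field; rewrite gt_eqF.
by rewrite ler_pdivrMr// ler_peMr// sqr_ge0.
Qed.

Lemma lvol_eball_ge a r : 0 < r ->
  (((2 * (r / d%:R)) ^+ d)%:E <= lvol (eball a r))%E.
Proof.
move=> r0; rewrite -(lvol_box a); last by rewrite divr_gt0// ltr0n.
apply: le_lvol; [exact: measurable_box|exact: measurable_eball|].
exact: box_sub_eball.
Qed.

Lemma lvol_eball_le a r : 0 < r -> (lvol (eball a r) <= ((2 * r) ^+ d)%:E)%E.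
Proof.
move=> r0; rewrite -(lvol_box a)//.
apply: le_lvol; [exact: measurable_eball|exact: measurable_box|].
by move=> x xr i; exact: eball_tnth.
Qed.

(** For positive radius [fine] loses nothing, as the ball lies in a cube of finite volume. The
    centre stays an argument, so translation invariance is never invoked. *)
Definition ballvol a r : R := fine (lvol (eball a r)).

Lemma ballvolE a r : 0 < r -> lvol (eball a r) = (ballvol a r)%:E.
Proof.
move=> r0; rewrite /ballvol fineK// ge0_fin_numE.
  exact: le_lt_trans (lvol_eball_le a r0) (ltry _).
by apply: leb_int_ge0 => z; rewrite lee_fin.
Qed.

Lemma ballvol_ge a r : 0 < r -> (2 * (r / d%:R)) ^+ d <= ballvol a r.
Proof. by move=> r0; rewrite -lee_fin -ballvolE//; exact: lvol_eball_ge. Qed.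

Lemma ballvol_gt0 a r : 0 < r -> 0 < ballvol a r.
Proof.
move=> r0; apply: lt_le_trans (ballvol_ge a r0).
by rewrite exprn_gt0// mulr_gt0// divr_gt0// ltr0n.
Qed.

End BallVolume.

(** * Integrals of p-th powers over a set, and Minkowski's inequality *)

Section PowerIntegral.
Context {R : realType} {d : nat} (p : R).
Implicit Types (f g : d.-tuple R -> R) (B : set (d.-tuple R)).

Lemma measurable_fun_bint f B :
  measurable_fun [set: d.-tuple R] f -> measurable B ->
  measurable_fun [set: d.-tuple R] (fun x => (\1_B x * (`|f x| `^ p))%:E).
Proof.
move=> mf mB; apply/measurable_EFinP; apply: measurable_funM.
  exact: measurable_indic.
apply: (@measurableT_comp _ _ _ _ _ _ (@powR R ^~ p)) => //.
exact: measurableT_comp.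
Qed.

Lemma bint_integrand_ge0 f B x : (0 <= (\1_B x * (`|f x| `^ p))%:E)%E.
Proof. by rewrite lee_fin mulr_ge0// powR_ge0. Qed.

Lemma bint_ge0 f B : (0 <= bint p f B)%E.
Proof. by apply: leb_int_ge0 => x; exact: bint_integrand_ge0. Qed.

Lemma le_bint f g B : 0 <= p -> measurable B ->
  measurable_fun [set: d.-tuple R] f -> measurable_fun [set: d.-tuple R] g ->
  (forall x, B x -> `|f x| <= `|g x|) -> (bint p f B <= bint p g B)%E.
Proof.
move=> p0 mB mf mg fg; apply: le_leb_int.
- exact: measurable_fun_bint.
- exact: measurable_fun_bint.
- by move=> x; exact: bint_integrand_ge0.
- move=> x; rewrite lee_fin indicE; case: (boolP (x \in B)) => [/set_mem Bx|_].
    by rewrite !mul1r ge0_ler_powR ?nnegrE//; exact: fg.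
  by rewrite !mul0r.
Qed.

Lemma bintZ f B c : measurable B -> measurable_fun [set: d.-tuple R] f ->
  bint p (fun x => c * f x) B = ((`|c| `^ p)%:E * bint p f B)%E.
Proof.
move=> mB mf; rewrite /bint -leb_intZl ?powR_ge0//.
- apply: eq_leb_int => x; rewrite -EFinM normrM powRM//.
  by congr EFin; ring.
- exact: measurable_fun_bint.
Qed.

(* Convexity of t^p with weights a / (a + b) and b / (a + b); integrated, it is
   Minkowski's inequality. *)
Lemma powR_normD_le (u v a b : R) : 1 <= p -> 0 < a -> 0 < b ->
  `|u + v| `^ p <= (a + b) `^ p *
    (a / (a + b) * a `^ (- p) * `|u| `^ p + b / (a + b) * b `^ (- p) * `|v| `^ p).
Proof.
move=> p1 a0 b0.
have ab0 : 0 < a + b by rewrite addr_gt0.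
pose t : R := a / (a + b).
have t01 : 0 <= t <= 1.
  by rewrite divr_ge0 ?(ltW a0) ?(ltW ab0)//= ler_pdivrMr// mul1r lerDl ltW.
have tC : 1 - t = b / (a + b) by rewrite /t; field; rewrite gt_eqF.
have conv (x y : R) : 0 <= x -> 0 <= y ->
    (t * x + (1 - t) * y) `^ p <= t * x `^ p + (1 - t) * y `^ p.
  move=> x0 y0; case/andP: t01 => t0 t1.
  have := convex_powR p1 (Itv01 t0 t1) (x := x) (y := y).
  by rewrite !inE/= !in_itv/= !andbT => /(_ x0 y0).
(* [|u| + |v|] is [a + b] times the mean of [|u| / a] and [|v| / b] with weights [t] and [1 - t];
   convexity is applied to this mean. *)
apply: (@le_trans _ _ (((a + b) *
    (t * (`|u| / a) + (1 - t) * (`|v| / b))) `^ p)).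
  rewrite ge0_ler_powR ?nnegrE ?(le_trans _ p1)//.
    rewrite mulr_ge0 ?(ltW ab0)// tC addr_ge0// mulr_ge0// divr_ge0// ltW//.
  rewrite tC /t.
  rewrite (_ : (a + b) * _ = `|u| + `|v|) ?ler_normD//.
  by field; rewrite !gt_eqF.
have ua : 0 <= `|u| / a by rewrite divr_ge0// ltW.
have vb : 0 <= `|v| / b by rewrite divr_ge0// ltW.
rewrite powRM ?(ltW ab0)//; last first.
  by rewrite tC addr_ge0// mulr_ge0// divr_ge0// ltW.
rewrite ler_pM2l ?powR_gt0//; apply: (le_trans (conv _ _ ua vb)).
rewrite !powRM ?invr_ge0 ?(ltW a0) ?(ltW b0)// tC.
have powRV x : 0 < x -> x^-1 `^ p = x `^ (- p).
  by move=> x0; rewrite -powR_inv1 ?ltW// -powRrM mulN1r.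
rewrite !powRV// /t le_eqVlt; apply/orP; left; apply/eqP; ring.
Qed.

(** Minkowski's inequality without p-th roots: [a], [b] bound the L^p norms in units of [C^(1/p)].
    Inserting the two bounds in the integrated convexity inequality leaves [(a + b)^p] times [C],
    since the weights [a / (a + b)] and [b / (a + b)] sum to 1. *)
Lemma bintD_le f g B (a b C : R) : 1 <= p -> 0 < a -> 0 < b -> 0 <= C ->
  measurable B -> measurable_fun [set: d.-tuple R] f ->
  measurable_fun [set: d.-tuple R] g ->
  (bint p f B <= (a `^ p * C)%:E)%E -> (bint p g B <= (b `^ p * C)%:E)%E ->
  (bint p (f \+ g)%R B <= ((a + b) `^ p * C)%:E)%E.
Proof.
move=> p1 a0 b0 C0 mB mf mg fa gb.
have ab0 : 0 < a + b by rewrite addr_gt0.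
pose A := (a + b) `^ p * (a / (a + b) * a `^ (- p)).
pose A' := (a + b) `^ p * (b / (a + b) * b `^ (- p)).
have A0 : 0 <= A by rewrite !mulr_ge0 ?powR_ge0 ?invr_ge0// ltW.
have A'0 : 0 <= A' by rewrite !mulr_ge0 ?powR_ge0 ?invr_ge0// ltW.
have mF := measurable_fun_bint mf mB; have mG := measurable_fun_bint mg mB.
apply: (@le_trans _ _ (A%:E * bint p f B + A'%:E * bint p g B)%E).
  rewrite /bint -!leb_intZl//; [|by move=> x; exact: bint_integrand_ge0..].
  rewrite -leb_intD//.
  - apply: le_leb_int.
    + by apply: measurable_fun_bint => //; exact: measurable_funD.
    + by apply: emeasurable_funD; exact: measurable_funeM.
    + by move=> x; exact: bint_integrand_ge0.
    + move=> x; rewrite -!EFinM -EFinD lee_fin.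
      have := powR_normD_le (f x) (g x) p1 a0 b0.
      move=> /(ler_wpM2l (ler0n _ (x \in B))); rewrite -indicE /A /A' /=.
      by move=> /le_trans; apply; lra.
  - exact: measurable_funeM.
  - exact: measurable_funeM.
  - by move=> x; rewrite mule_ge0// bint_integrand_ge0.
  - by move=> x; rewrite mule_ge0// bint_integrand_ge0.
apply: (@le_trans _ _ (A%:E * (a `^ p * C)%:E + A'%:E * (b `^ p * C)%:E)%E).
  by rewrite leeD// lee_pmul// ?lee_fin//; exact: bint_ge0.
rewrite -!EFinM -EFinD lee_fin /A /A' !powRN.
rewrite le_eqVlt; apply/orP; left; apply/eqP; field.
by rewrite !gt_eqF// powR_gt0.
Qed.

End PowerIntegral.

(** * The Morrey norm as a seminorm *)

Section MorreyNorm.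
Context {R : realType} {d : nat} (p q : R).
Hypotheses (d_gt0 : (0 < d)%N) (p1 : 1 <= p) (pq : p < q).
Implicit Types (f g : d.-tuple R -> R).

Let p0 : 0 < p. Proof. by rewrite (lt_le_trans _ p1). Qed.
Let q0 : 0 < q. Proof. exact: lt_trans pq. Qed.

(* The inequality |B|^(1/q - 1/p) (int_B |f|^p)^(1/p) <= c, with the powers moved
   to the right-hand side so that it is linear in the integral. *)
Definition morrey_bound f (c : R) := forall (a : d.-tuple R) (r : R), 0 < r ->
  (bint p f (eball a r) <= (c `^ p * ballvol a r `^ (1 - p / q))%:E)%E.

(** As [1/q - 1/p = - (1 - p/q) / p], the volume factor can be moved to the right; raising to the
    power [p] is monotone on nonnegative reals in both directions. *)
Let powR_bound (v I c : R) : 0 < v -> 0 <= I -> 0 <= c ->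
  (v `^ (q^-1 - p^-1) * I `^ p^-1 <= c) = (I <= c `^ p * v `^ (1 - p / q)).
Proof.
move=> v0 I0 c0.
have pN0 : p != 0 by rewrite gt_eqF.
have w0 : 0 < v `^ (1 - p / q) by rewrite powR_gt0.
have -> : v `^ (q^-1 - p^-1) = (v `^ (1 - p / q)) `^ (- p^-1).
  by rewrite -powRrM; congr (_ `^ _); field; rewrite !gt_eqF.
rewrite powRN mulrC ler_pdivrMr ?powR_gt0//.
have -> : c * (v `^ (1 - p / q)) `^ p^-1 = (c `^ p * v `^ (1 - p / q)) `^ p^-1.
  by rewrite powRM ?powR_ge0 ?(ltW w0)// -[in RHS]powRrM divff// powRr1.
have cw0 : 0 <= c `^ p * v `^ (1 - p / q) by rewrite mulr_ge0 ?powR_ge0.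
apply/idP/idP => [h|h].
  have := ge0_ler_powR (ltW p0) (powR_ge0 _ _) (powR_ge0 _ _) h.
  by rewrite -!powRrM mulVf// !powRr1.
by rewrite ge0_ler_powR ?nnegrE// invr_ge0 ltW.
Qed.

Lemma morrey_enorm_le f (c : R) : 0 <= c ->
  (morrey_enorm p q f <= c%:E)%E <-> morrey_bound f c.
Proof.
move=> c0.
have ballE (a : d.-tuple R) (r : R) : 0 < r ->
    (poweR (lvol (eball a r)) (q^-1 - p^-1) *
      poweR (bint p f (eball a r)) p^-1 <= c%:E)%E =
    (bint p f (eball a r) <= (c `^ p * ballvol a r `^ (1 - p / q))%:E)%E.
  move=> r0; rewrite ballvolE// poweR_EFin.
  have v0 := ballvol_gt0 d_gt0 a r0.
  case: (bint p f (eball a r)) (bint_ge0 p f (eball a r)) => [I I0|_|//].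
    by rewrite poweR_EFin -EFinM !lee_fin powR_bound.
  (* An infinite integral makes both inequalities false, because the volume factor is positive. *)
  by rewrite poweRyr ?invr_neq0 ?gt_eqF// gt0_muley// lte_fin powR_gt0.
split=> [h a r r0|h].
  by rewrite -ballE//; apply: le_trans h; apply: ereal_sup_ubound; exists a, r.
by apply: ge_ereal_sup => _ [a [r [r0 ->]]]; rewrite ballE//; exact: h.
Qed.

Lemma morrey_enorm_ge0 f : (0 <= morrey_enorm p q f)%E.
Proof.
pose a : d.-tuple R := [tuple of nseq d 0].
apply: (@le_trans _ _ (poweR (lvol (eball a 1)) (q^-1 - p^-1) *
    poweR (bint p f (eball a 1)) p^-1)%E).
  by rewrite mule_ge0// poweR_ge0.
by apply: ereal_sup_ubound; exists a, 1.
Qed.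

Lemma morrey_norm_ge0 f : 0 <= morrey_norm p q f.
Proof. exact: fine_ge0 (morrey_enorm_ge0 f). Qed.

Lemma morrey_enormE f : Morrey p q f ->
  morrey_enorm p q f = (morrey_norm p q f)%:E.
Proof.
move=> [_ fy]; rewrite /morrey_norm fineK// ge0_fin_numE//.
exact: morrey_enorm_ge0.
Qed.

Lemma Morrey_bound f (c : R) : 0 <= c -> measurable_fun [set: d.-tuple R] f ->
  morrey_bound f c -> Morrey p q f.
Proof.
move=> c0 mf /(morrey_enorm_le _ c0) fc; split=> //.
exact: le_lt_trans fc (ltry _).
Qed.

Lemma morrey_norm_le f (c : R) : Morrey p q f -> 0 <= c ->
  morrey_norm p q f <= c <-> morrey_bound f c.
Proof. by move=> Xf c0; rewrite -morrey_enorm_le// morrey_enormE// lee_fin. Qed.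

Lemma morrey_norm_bound f : Morrey p q f -> morrey_bound f (morrey_norm p q f).
Proof. by move=> Xf; apply/morrey_norm_le => //; exact: morrey_norm_ge0. Qed.

Lemma le_morrey_bound f (c c' : R) : 0 <= c -> c <= c' ->
  morrey_bound f c -> morrey_bound f c'.
Proof.
move=> c0 cc' fc a r r0; apply: le_trans (fc a r r0) _.
rewrite lee_fin ler_wpM2r ?powR_ge0//.
by rewrite ge0_ler_powR ?nnegrE ?(ltW p0) ?(le_trans c0).
Qed.

Lemma morrey_boundD f g (a b : R) : 0 < a -> 0 < b ->
  measurable_fun [set: d.-tuple R] f -> measurable_fun [set: d.-tuple R] g ->
  morrey_bound f a -> morrey_bound g b -> morrey_bound (f \+ g) (a + b).
Proof.
move=> a0 b0 mf mg fa gb u r r0; apply: bintD_le => //; first exact: powR_ge0.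
- exact: measurable_eball.
- exact: fa.
- exact: gb.
Qed.

Lemma morrey_boundZ f (k c : R) : 0 <= c -> measurable_fun [set: d.-tuple R] f ->
  morrey_bound f c -> morrey_bound (fun x => k * f x) (`|k| * c).
Proof.
move=> c0 mf fc a r r0; rewrite bintZ//; last exact: measurable_eball.
rewrite powRM// -mulrA [X in (_ <= X)%E]EFinM lee_wpmul2l ?lee_fin ?powR_ge0//.
exact: fc.
Qed.

(** [morrey_boundD] asks for positive bounds while a norm may vanish, hence the slack [e]. Closure
    under sums takes [e = 1]; the triangle inequality lets the slack tend to 0. *)
Let bound_eps f (e : R) : Morrey p q f -> 0 < e ->
  morrey_bound f (morrey_norm p q f + e).
Proof.
move=> Xf e0; apply: le_morrey_bound (morrey_norm_bound Xf).
  exact: morrey_norm_ge0.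
by rewrite lerDl ltW.
Qed.

Lemma MorreyD f g : Morrey p q f -> Morrey p q g -> Morrey p q (f \+ g).
Proof.
move=> Xf Xg; have N1 (h : d.-tuple R -> R) : 0 < morrey_norm p q h + 1.
  by rewrite ltr_wpDl ?morrey_norm_ge0.
apply: (@Morrey_bound _ ((morrey_norm p q f + 1) + (morrey_norm p q g + 1))).
- exact: ltW (addr_gt0 (N1 _) (N1 _)).
- by apply: measurable_funD; [case: Xf|case: Xg].
- apply: (morrey_boundD (N1 _) (N1 _) Xf.1 Xg.1).
    exact: (bound_eps Xf ltr01).
  exact: (bound_eps Xg ltr01).
Qed.

Lemma morrey_normD f g : Morrey p q f -> Morrey p q g ->
  morrey_norm p q (f \+ g) <= morrey_norm p q f + morrey_norm p q g.
Proof.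
move=> Xf Xg; apply/ler_addgt0Pr => e e0.
have e20 : 0 < e / 2 by rewrite divr_gt0.
have Ne (h : d.-tuple R -> R) : 0 < morrey_norm p q h + e / 2.
  by rewrite ltr_wpDl ?morrey_norm_ge0.
have -> : morrey_norm p q f + morrey_norm p q g + e =
    (morrey_norm p q f + e / 2) + (morrey_norm p q g + e / 2).
  by rewrite addrACA -splitr.
apply: (morrey_norm_le (MorreyD Xf Xg) (ltW (addr_gt0 (Ne _) (Ne _)))).2.
apply: (morrey_boundD (Ne _) (Ne _) Xf.1 Xg.1).
  exact: (bound_eps Xf e20).
exact: (bound_eps Xg e20).
Qed.

Lemma MorreyZ (k : R) f : Morrey p q f -> Morrey p q (fun x => k * f x).
Proof.
move=> Xf; apply: (@Morrey_bound _ (`|k| * morrey_norm p q f)).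
- by rewrite mulr_ge0// morrey_norm_ge0.
- by apply: measurable_funM => //; case: Xf.
- apply: morrey_boundZ; [exact: morrey_norm_ge0|by case: Xf|].
  exact: morrey_norm_bound.
Qed.

Lemma morrey_normZ (k : R) f : Morrey p q f ->
  morrey_norm p q (fun x => k * f x) = `|k| * morrey_norm p q f.
Proof.
have le_normZ (l : R) (h : d.-tuple R -> R) : Morrey p q h ->
    morrey_norm p q (fun x => l * h x) <= `|l| * morrey_norm p q h.
  move=> Xh; apply/morrey_norm_le; first exact: MorreyZ.
    by rewrite mulr_ge0// morrey_norm_ge0.
  apply: morrey_boundZ; [exact: morrey_norm_ge0|by case: Xh|].
  exact: morrey_norm_bound.
move=> Xf; apply/eqP; rewrite eq_le le_normZ//=.
have [->|k0] := eqVneq k 0; first by rewrite normr0 mul0r morrey_norm_ge0.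
(* The reverse inequality is the same bound with factor [k^-1], applied to [k * f]. *)
have := le_normZ k^-1 _ (MorreyZ k Xf).
rewrite (_ : (fun x => _) = f); last by apply/funext => x; rewrite mulKf.
by rewrite normfV ler_pdivlMl ?normr_gt0.
Qed.

Lemma le_morrey_norm f g : Morrey p q f -> Morrey p q g ->
  (forall x, `|f x| <= `|g x|) -> morrey_norm p q f <= morrey_norm p q g.
Proof.
move=> Xf Xg fg; apply/morrey_norm_le => //; first exact: morrey_norm_ge0.
move=> a r r0; apply: (@le_trans _ _ (bint p g (eball a r))); last first.
  exact: morrey_norm_bound.
apply: le_bint => //; [exact: ltW|exact: measurable_eball|by case: Xf|by case: Xg].
Qed.

End MorreyNorm.

(** * Upper bounds for the three constants in a seminormed space *)

Section GeometricConstants.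
Context {R : realType} {T : Type} (X : set (T -> R)) (N : (T -> R) -> R).
Hypothesis N_ge0 : forall f, X f -> 0 <= N f.
Hypothesis XD : forall f g, X f -> X g -> X (f \+ g).
Hypothesis XZ : forall c f, X f -> X (fun t => c * f t).
Hypothesis ND : forall f g, X f -> X g -> N (f \+ g) <= N f + N g.
Hypothesis NZ : forall c f, X f -> N (fun t => c * f t) = `|c| * N f.

Let subE (f g : T -> R) : f \- g = f \+ (fun t => (-1) * g t).
Proof. by apply/funext => t /=; rewrite mulN1r. Qed.

Let XB f g : X f -> X g -> X (f \- g).
Proof. by move=> Xf Xg; rewrite subE; apply: XD => //; exact: XZ. Qed.

Let NB f g : X f -> X g -> N (f \- g) <= N f + N g.
Proof.
move=> Xf Xg; rewrite subE; apply: (le_trans (ND Xf (XZ (-1) Xg))).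
by rewrite NZ// normrN1 mul1r.
Qed.

Let N_subC f g : X f -> X g -> N (g \- f) = N (f \- g).
Proof.
move=> Xf Xg; have -> : g \- f = (fun t => (-1) * (f \- g) t).
  by apply/funext => t /=; ring.
by rewrite NZ ?normrN1 ?mul1r//; exact: XB.
Qed.

Let N_gt0 f : X f -> N f != 0 -> 0 < N f.
Proof. by move=> Xf Nf; rewrite lt_neqAle eq_sym Nf N_ge0. Qed.

(** Both norms in the numerator are at most [N x + N y], and
    [2 (N x + N y)^2 <= 4 (N x ^ 2 + N y ^ 2)] because [(N x - N y)^2 >= 0]. *)
Lemma C_NJ_le2 : (C_NJ X N <= 2%:E)%E.
Proof.
apply: ge_ereal_sup => _ [x [y [Xx [Xy [/(N_gt0 Xx) x0 [/(N_gt0 Xy) y0 ->]]]]]].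
have h1 := ND Xx Xy; have h2 := NB Xx Xy.
have p1 := N_ge0 (XD Xx Xy); have p2 := N_ge0 (XB Xx Xy).
rewrite lee_fin ler_pdivrMr; last nra.
have q1 : N (x \+ y) ^+ 2 <= (N x + N y) ^+ 2 by rewrite lerXn2r ?nnegrE//; lra.
have q2 : N (x \- y) ^+ 2 <= (N x + N y) ^+ 2 by rewrite lerXn2r ?nnegrE//; lra.
have : 0 <= (N x - N y) ^+ 2 by exact: sqr_ge0.
lra.
Qed.

Lemma C_J_le2 : (C_J X N <= 2%:E)%E.
Proof.
apply: ge_ereal_sup => _ [x [y [Xx [Xy [x1 [y1 ->]]]]]].
by rewrite lee_fin ge_min (le_trans (ND Xx Xy))// x1 y1; lra.
Qed.

(** [N x * (x / N x - y / N y)] equals [(x - y) + ((N y - N x) / N y) * y], whose second summand has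
    norm [|N y - N x| <= N (x - y)]. *)
Let N_normalize_le x y : X x -> X y -> N x != 0 -> N y != 0 ->
  N x * N ((fun t => x t / N x) \- (fun t => y t / N y)) <= 2 * N (x \- y).
Proof.
move=> Xx Xy Nx Ny.
have Nx0 := N_gt0 Xx Nx; have Ny0 := N_gt0 Xy Ny.
have XB1 : X ((fun t => x t / N x) \- (fun t => y t / N y)).
  rewrite (_ : _ \- _ =
    (fun t => (N x)^-1 * x t) \- (fun t => (N y)^-1 * y t)); last first.
    by apply/funext => t /=; ring.
  by apply: XB; exact: XZ.
have -> : N x * N ((fun t => x t / N x) \- (fun t => y t / N y)) =
    N ((x \- y) \+ (fun t => ((N y - N x) / N y) * y t)).
  rewrite -{1}(ger0_norm (ltW Nx0)) -NZ//; congr N; apply/funext => t /=.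
  by field; rewrite Nx Ny.
apply: (le_trans (ND (XB Xx Xy) (XZ _ Xy))).
rewrite NZ// normrM normfV (ger0_norm (ltW Ny0)) divfK// mulrDl mul1r lerD2l.
have h1 : N x <= N (x \- y) + N y.
  apply: le_trans (ND (XB Xx Xy) Xy); rewrite le_eqVlt; apply/orP; left.
  by apply/eqP; congr N; apply/funext => t /=; ring.
have h2 : N y <= N (x \- y) + N x.
  rewrite -(N_subC Xx Xy).
  apply: le_trans (ND (XB Xy Xx) Xx); rewrite le_eqVlt; apply/orP; left.
  by apply/eqP; congr N; apply/funext => t /=; ring.
by rewrite ler_norml; lra.
Qed.

(** Distributing [N x + N y] leaves two terms; [N_normalize_le], used for [(x, y)] and for [(y, x)],
    bounds each by [2 * N (x - y)]. *)
Lemma C_DW_le4 : (C_DW X N <= 4%:E)%E.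
Proof.
apply: ge_ereal_sup => _ [x [y [Xx [Xy [Nx [Ny [Nxy ->]]]]]]].
have Nxy0 := N_gt0 (XB Xx Xy) Nxy.
rewrite lee_fin mulrAC ler_pdivrMr// mulrDl.
have h1 := N_normalize_le Xx Xy Nx Ny.
have := N_normalize_le Xy Xx Ny Nx; rewrite (N_subC Xx Xy).
have -> : (fun t => y t / N y) \- (fun t => x t / N x) =
   (fun t => (-1) * ((fun t => x t / N x) \- (fun t => y t / N y)) t).
  by apply/funext => t /=; ring.
rewrite NZ; first by rewrite normrN1 mul1r; lra.
rewrite (_ : _ \- _ =
  (fun t => (N x)^-1 * x t) \- (fun t => (N y)^-1 * y t)); last first.
  by apply/funext => t /=; ring.
by apply: XB; exact: XZ.
Qed.

(** * Sharpness of the bounds when [g] and [h] span a plane with the maximum norm *)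

Variables g h : T -> R.
Hypotheses (Xg : X g) (Xh : X h).
Hypothesis N_max : forall a b,
  N (fun t => a * g t + b * h t) = Num.max `|a| `|b|.

Let Xlin a b : X (fun t => a * g t + b * h t).
Proof. by apply: (XD (f := fun t => _) (g := fun t => _)); exact: XZ. Qed.

(** In coordinates along [g] and [h]: the corners [(1, 1)] and [(1, -1)] of the unit square, with
    sum [(2, 0)] and difference [(0, 2)]. They are extremal for both [C_NJ] and [C_J]. *)
Let x1 := fun t => 1 * g t + 1 * h t.
Let y1 := fun t => 1 * g t + (-1) * h t.

Let N_x1 : N x1 = 1. Proof. by rewrite N_max normr1 maxxx. Qed.
Let N_y1 : N y1 = 1. Proof. by rewrite N_max normrN1 normr1 maxxx. Qed.
Let N_x1Dy1 : N (x1 \+ y1) = 2.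
Proof.
rewrite (_ : _ \+ _ = (fun t => 2 * g t + 0 * h t)).
  by rewrite N_max normr0 ger0_norm// max_l.
by apply/funext => t; rewrite /x1 /y1 /=; ring.
Qed.
Let N_x1By1 : N (x1 \- y1) = 2.
Proof.
rewrite (_ : _ \- _ = (fun t => 0 * g t + 2 * h t)).
  by rewrite N_max normr0 ger0_norm// max_r.
by apply/funext => t; rewrite /x1 /y1 /=; ring.
Qed.

Lemma C_NJ_eq2 : C_NJ X N = 2%:E.
Proof.
apply/eqP; rewrite eq_le C_NJ_le2/=; apply: ereal_sup_ubound.
exists x1, y1; do 2 (split; first exact: Xlin).
rewrite N_x1 N_y1 N_x1Dy1 N_x1By1; do 2 (split; first exact: oner_neq0).
by congr EFin; field.
Qed.

Lemma C_J_eq2 : C_J X N = 2%:E.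
Proof.
apply/eqP; rewrite eq_le C_J_le2/=; apply: ereal_sup_ubound.
exists x1, y1; do 2 (split; first exact: Xlin).
by rewrite N_x1 N_y1 N_x1Dy1 N_x1By1 minxx.
Qed.

(* For the maximum norm on the plane, (1, 1) and (1 - e, 1 + e) give the
   quotient (4 + 2e) / (1 + e). *)
Lemma C_DW_eq4 : C_DW X N = 4%:E.
Proof.
apply/eqP; rewrite eq_le C_DW_le4/=; apply/lee_subgt0Pr => e e0.
(* The quotient is [4 - 2d / (1 + d) >= 4 - 2d], so [d <= e / 2] suffices; [d <= 1] keeps [1 - d]
   nonnegative. *)
pose d := Num.min (e / 2) 1.
have d0 : 0 < d by rewrite lt_min divr_gt0 ?ltr01.
have de : d <= e / 2 by rewrite ge_min lexx.
have d1 : d <= 1 by rewrite ge_min lexx orbT.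
pose y2 := fun t => (1 - d) * g t + (1 + d) * h t.
have N_y2 : N y2 = 1 + d.
  by rewrite N_max !ger0_norm ?max_r//; lra.
have N_x1By2 : N (x1 \- y2) = d.
  rewrite (_ : _ \- _ = (fun t => d * g t + (- d) * h t)).
    by rewrite N_max normrN maxxx ger0_norm// ltW.
  by apply/funext => t; rewrite /x1 /y2 /=; ring.
(* Normalising gives both vectors second coordinate 1, so only the first coordinate
   [1 - (1 - d) / (1 + d)] of the difference survives. *)
have N_xy : N ((fun t => x1 t / N x1) \- (fun t => y2 t / N y2)) =
    2 * d / (1 + d).
  rewrite N_x1 N_y2 (_ : _ \- _ =
    (fun t => (2 * d / (1 + d)) * g t + 0 * h t)).
    rewrite N_max normr0 ger0_norm ?max_l//.
      by rewrite divr_ge0//; lra.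
    by rewrite divr_ge0//; lra.
  by apply/funext => t; rewrite /x1 /y2 /=; field; lra.
apply: (@le_trans _ _ (((N x1 + N y2) / N (x1 \- y2) *
    N ((fun t => x1 t / N x1) \- (fun t => y2 t / N y2)))%:E)).
  rewrite N_xy N_x1By2 N_x1 N_y2 -EFinB lee_fin.
  have -> : (1 + (1 + d)) / d * (2 * d / (1 + d)) = (4 + 2 * d) / (1 + d).
    by field; apply/andP; split; lra.
  by rewrite ler_pdivlMr; nra.
apply: ereal_sup_ubound; exists x1, y2; do 2 (split; first exact: Xlin).
rewrite N_x1 N_y2 N_x1By2; split; first exact: oner_neq0.
by split; [apply/negP => /eqP; lra|split=> //; rewrite gt_eqF].
Qed.

End GeometricConstants.

(** * Two distant normalised bumps spanning a plane with the maximum norm *)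

Section FarApartBumps.
Context {R : realType} {d : nat} (p q : R).
Hypotheses (d_gt0 : (0 < d)%N) (p1 : 1 <= p) (pq : p < q).
Implicit Types (a b : d.-tuple R) (r : R).

Let p0 : 0 < p. Proof. by rewrite (lt_le_trans _ p1). Qed.
Let q0 : 0 < q. Proof. exact: lt_trans pq. Qed.
(** The volume exponent in [morrey_bound]. It is positive because [p < q], so the permitted mass
    grows with the ball. *)
Let th := 1 - p / q.
Let th0 : 0 < th. Proof. by rewrite subr_gt0 ltr_pdivrMr// mul1r. Qed.

Definition bump a : d.-tuple R -> R :=
  fun x => ballvol a 1 `^ (- q^-1) * \1_(eball a 1) x.

Lemma bump_ge0 a x : 0 <= bump a x.
Proof. by rewrite mulr_ge0 ?powR_ge0. Qed.

Lemma bump_eq0 a x : ~ eball a 1 x -> bump a x = 0.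
Proof. by move=> ax; rewrite /bump indicE memNset ?mulr0. Qed.

Lemma measurable_bump a : measurable_fun [set: d.-tuple R] (bump a).
Proof.
apply: measurable_funM => //.
by apply: measurable_indic; exact: measurable_eball.
Qed.

Lemma bint_bump a B : measurable B -> bint p (bump a) B =
  ((ballvol a 1 `^ (- (p / q)))%:E * lvol (B `&` eball a 1))%E.
Proof.
move=> mB; rewrite bintZ//; last first.
  by apply: measurable_indic; exact: measurable_eball.
congr (_%:E * _)%E.
  by rewrite ger0_norm ?powR_ge0// -powRrM; congr (_ `^ _); ring.
apply: eq_leb_int => x; congr (_%:E); rewrite indicI/=; congr (_ * _).
rewrite indicE; case: (x \in eball a 1).
  by rewrite normr1 powR1.
by rewrite normr0 powR0// gt_eqF.
Qed.

(** With [E] the unit ball and [m] the volume of its intersection with [B], the integral is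
    [(m / |E|)^(p/q) * m^th], and [m <= |E|]. Both the volume of [B] and the uniform bound [2 ^ d]
    serve as [c]. *)
Lemma bint_bump_le a B (c : R) : measurable B -> 0 <= c ->
  (lvol (B `&` eball a 1) <= c%:E)%E ->
  (bint p (bump a) B <= (c `^ th)%:E)%E.
Proof.
move=> mB c0 Bc; rewrite bint_bump//.
have v0 := ballvol_gt0 d_gt0 a (@ltr01 R).
have mE : measurable (eball a 1) by exact: measurable_eball.
have : (lvol (B `&` eball a 1) <= (ballvol a 1)%:E)%E.
  by rewrite -ballvolE//; apply: le_lvol => //; exact: measurableI.
have : (0 <= lvol (B `&` eball a 1))%E.
  by apply: leb_int_ge0 => x; rewrite lee_fin.
case: (lvol _) Bc => [m| |] //; rewrite !lee_fin => mc m0 mv.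
have -> : m = m `^ (p / q) * m `^ th.
  by rewrite -powRD /th addrC subrK ?powRr1// oner_eq0.
have pq0 : 0 <= p / q by rewrite divr_ge0// ltW.
rewrite powRN mulrA; apply: (@le_trans _ _ (1 * m `^ th)).
  rewrite ler_wpM2r ?powR_ge0// mulrC ler_pdivrMr ?powR_gt0// mul1r.
  by rewrite ge0_ler_powR ?nnegrE// ltW.
by rewrite mul1r ge0_ler_powR ?nnegrE// ltW.
Qed.

Lemma bump_bound a : morrey_bound p q (bump a) 1.
Proof.
move=> b r r0; rewrite powR1 mul1r.
have mB : measurable (eball b r) by exact: measurable_eball.
apply: bint_bump_le => //; first by rewrite ltW// ballvol_gt0.
rewrite -ballvolE//; apply: le_lvol => //.
by apply: measurableI => //; exact: measurable_eball.
Qed.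

Lemma Morrey_bump a : Morrey p q (bump a).
Proof.
exact: (Morrey_bound d_gt0 p1 pq ler01 (measurable_bump a) (bump_bound a)).
Qed.

(** The supporting ball attains the bound: there the integral is [|E|^(1 - p/q)], so a norm [N]
    satisfies [1 <= N^p]. *)
Lemma morrey_norm_bump a : morrey_norm p q (bump a) = 1.
Proof.
have N0 := morrey_norm_ge0 p q (bump a).
apply/eqP; rewrite eq_le; apply/andP; split.
  by apply/morrey_norm_le => //; [exact: Morrey_bump|exact: bump_bound].
have v0 := ballvol_gt0 d_gt0 a (@ltr01 R).
have := morrey_norm_bound d_gt0 p1 pq (Morrey_bump a) a ltr01.
rewrite bint_bump ?setIid; last exact: measurable_eball.
rewrite ballvolE// -EFinM lee_fin -[X in _ * X <= _](powRr1 (ltW v0)).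
rewrite -powRD; last by rewrite (gt_eqF v0) implybT.
rewrite addrC -ler_pdivrMr ?powR_gt0// divff ?gt_eqF ?powR_gt0// => h.
rewrite leNgt; apply/negP => N1.
have := gt0_ltr_powR p0 N0 ler01 N1.
by rewrite powR1 ltNge h.
Qed.

(* Chosen so that a ball meeting both unit balls has radius at least d K, hence
   volume at least 2^d K, where K^th = 2^p absorbs the constant of bintD_le. *)
Let K : R := 2 `^ (p / th).
Let L : R := 2 + 2 * (d%:R * K).
Let a0 : d.-tuple R := [tuple of nseq d 0].
Let aL : d.-tuple R := [tuple of nseq d L].

Let K1 : 1 <= K.
Proof.
by rewrite /K -[X in X <= _](powRr0 2) ler_powR ?ler1n// divr_ge0// ltW.
Qed.

Let L2 : 2 <= L.
Proof. by rewrite /L lerDl !mulr_ge0// (le_trans ler01 K1). Qed.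

Let bumps_disjoint x : ~ (eball a0 1 x /\ eball aL 1 x).
Proof.
move=> [/(eball_tnth (Ordinal d_gt0) ltr01) h1].
move=> /(eball_tnth (Ordinal d_gt0) ltr01).
move: h1 L2; rewrite !tnth_nseq !ltr_norml; lra.
Qed.

(** First coordinates of the two points differ by more than [L - 2 = 2 * (d * K)], yet by less than
    [2 * r] inside the ball. *)
Let big_radius b r x y : 0 < r -> eball b r x -> eball a0 1 x ->
  eball b r y -> eball aL 1 y -> d%:R * K <= r.
Proof.
move=> r0 /(eball_tnth (Ordinal d_gt0) r0) h1 /(eball_tnth (Ordinal d_gt0) ltr01) h2.
move=> /(eball_tnth (Ordinal d_gt0) r0) h3 /(eball_tnth (Ordinal d_gt0) ltr01).
move: h1 h2 h3; rewrite !tnth_nseq !ltr_norml /L; lra.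
Qed.

Let bumpD_bound : morrey_bound p q (bump a0 \+ bump aL) 1.
Proof.
move=> b r r0; set B := eball b r.
have mB : measurable B by exact: measurable_eball.
(* If [B] misses one of the unit balls, the sum coincides on [B] with the other bump, and
   [bump_bound] applies. *)
have [[x [Bx Ex]]|nE] := pselect (exists x, B x /\ eball a0 1 x); last first.
  apply: (@le_trans _ _ (bint p (bump aL) B)); last exact: bump_bound.
  apply: le_bint => //; [exact: ltW| |exact: measurable_bump|].
    by apply: measurable_funD; exact: measurable_bump.
  move=> x Bx /=; rewrite bump_eq0 ?add0r// => Ex.
  by apply: nE; exists x.
have [[y [By Fy]]|nF] := pselect (exists x, B x /\ eball aL 1 x); last first.
  apply: (@le_trans _ _ (bint p (bump a0) B)); last exact: bump_bound.
  apply: le_bint => //; [exact: ltW| |exact: measurable_bump|].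
    by apply: measurable_funD; exact: measurable_bump.
  move=> z Bz /=; rewrite [bump aL z]bump_eq0 ?addr0// => Fz.
  by apply: nF; exists z.
have dKr := big_radius r0 Bx Ex By Fy.
have bump_le a : (bint p (bump a) B <= (1 `^ p * (2 ^+ d) `^ th)%:E)%E.
  rewrite powR1 mul1r; apply: bint_bump_le => //.
  rewrite -[2]mulr1; apply: le_trans (lvol_eball_le a ltr01).
  have mE : measurable (eball a 1) by exact: measurable_eball.
  by apply: le_lvol => //; exact: measurableI.
apply: le_trans (bintD_le p1 ltr01 ltr01 (powR_ge0 _ _) mB
  (measurable_bump _) (measurable_bump _) (bump_le a0) (bump_le aL)) _.
have d0 : 0 < d%:R :> R by rewrite ltr0n.
have K0 : 0 < K by rewrite (lt_le_trans ltr01 K1).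
have Kr : K <= r / d%:R by rewrite ler_pdivlMr// mulrC.
(* The inscribed cube has half side at least [K], and [K <= K ^ d] since [K >= 1]. *)
have Kd : 2 ^+ d * K <= ballvol b r.
  apply: le_trans (ballvol_ge d_gt0 b r0).
  rewrite exprMn ler_wpM2l ?exprn_ge0//.
  apply: (@le_trans _ _ (K ^+ d)); last first.
    by rewrite lerXn2r ?nnegrE// ltW// (lt_le_trans K0).
  by rewrite ler_eXnr.
rewrite lee_fin powR1 mul1r.
(* Minkowski's factor [2^p] is absorbed: [K^th * (2^d)^th = (2^d * K)^th], at most the volume of [B]
   to the power [th]. *)
have -> : (1 + 1) `^ p = K `^ th :> R.
  by rewrite /K -powRrM divfK ?gt_eqF.
rewrite mulrC -powRM ?exprn_ge0 ?(ltW K0)//.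
rewrite ge0_ler_powR ?nnegrE ?(ltW th0)//.
  by rewrite mulr_ge0 ?exprn_ge0 ?ltW.
by rewrite ltW// ballvol_gt0.
Qed.

Lemma bumps_linfty2 : exists g h : d.-tuple R -> R,
  [/\ Morrey p q g, Morrey p q h & forall s t : R,
   morrey_norm p q (fun x => s * g x + t * h x) = Num.max `|s| `|t|].
Proof.
exists (bump a0), (bump aL); split; [exact: Morrey_bump|exact: Morrey_bump|].
move=> s t.
have Xst (s' t' : R) : Morrey p q (fun x => s' * bump a0 x + t' * bump aL x).
  exact: (MorreyD d_gt0 p1 pq (MorreyZ d_gt0 p1 pq s' (Morrey_bump a0))
    (MorreyZ d_gt0 p1 pq t' (Morrey_bump aL))).
have XD := MorreyD d_gt0 p1 pq (Morrey_bump a0) (Morrey_bump aL).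
have disj x : bump a0 x = 0 \/ bump aL x = 0.
  have [h0|/bump_eq0] := pselect (eball a0 1 x); last by left.
  by right; apply: bump_eq0 => hL; exact: (@bumps_disjoint x).
apply/eqP; rewrite eq_le; apply/andP; split.
  (* Upper bound: the sum is dominated pointwise by [m] times the sum of the two bumps, whose norm
     is at most 1. *)
  set m := Num.max _ _.
  have m0 : 0 <= m by rewrite le_max normr_ge0.
  apply: (@le_trans _ _ (morrey_norm p q
      (fun x => m * (bump a0 \+ bump aL) x))).
    apply: (le_morrey_norm d_gt0 p1 pq (Xst _ _) (MorreyZ d_gt0 p1 pq m XD)).
    move=> x; have g0 := bump_ge0 a0 x; have h0 := bump_ge0 aL x.
    rewrite [X in _ <= X]ger0_norm ?mulr_ge0 ?addr_ge0//=.
    rewrite mulrDr (le_trans (ler_normD _ _))// (normrM s) (normrM t).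
    by rewrite (ger0_norm g0) (ger0_norm h0) lerD// ler_wpM2r// le_max lexx ?orbT.
  rewrite morrey_normZ// ger0_norm// ler_piMr//.
  by apply/morrey_norm_le.
(* Lower bound: as the supports are disjoint, each scaled bump is dominated pointwise by the
   combination. *)
rewrite ge_max; apply/andP; split.
  rewrite -[X in X <= _]mulr1 -(morrey_norm_bump a0).
  rewrite -(morrey_normZ d_gt0 p1 pq s (Morrey_bump a0)).
  apply: (le_morrey_norm d_gt0 p1 pq _ (Xst _ _)).
    exact: (MorreyZ d_gt0 p1 pq s (Morrey_bump a0)).
  by move=> x; case: (disj x) => ->; rewrite !mulr0 ?addr0// normr0.
rewrite -[X in X <= _]mulr1 -(morrey_norm_bump aL).
rewrite -(morrey_normZ d_gt0 p1 pq t (Morrey_bump aL)).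
apply: (le_morrey_norm d_gt0 p1 pq _ (Xst _ _)).
  exact: (MorreyZ d_gt0 p1 pq t (Morrey_bump aL)).
by move=> x; case: (disj x) => ->; rewrite !mulr0 ?add0r// normr0.
Qed.

End FarApartBumps.

(** * The seminorm properties and the embedded plane give the three constants *)

Theorem theorem1 (R : realType) (d : nat) (p q : R) :
  (1 <= d)%N -> 1 <= p -> p < q ->
  C_NJ (@Morrey R d p q) (@morrey_norm R d p q) = 2%:E /\
  C_J (@Morrey R d p q) (@morrey_norm R d p q) = 2%:E /\
  C_DW (@Morrey R d p q) (@morrey_norm R d p q) = 4%:E.
Proof.
move=> d0 p1 pq; have [g [h [Xg Xh N_max]]] := bumps_linfty2 d0 p1 pq.
have N0 (f : d.-tuple R -> R) : Morrey p q f -> 0 <= morrey_norm p q f.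
  by move=> _; exact: morrey_norm_ge0.
have XD := MorreyD d0 p1 pq; have XZ := MorreyZ d0 p1 pq.
have ND := morrey_normD d0 p1 pq; have NZ := morrey_normZ d0 p1 pq.
split; first exact: (C_NJ_eq2 N0 XD XZ ND NZ Xg Xh N_max).
split; first exact: (C_J_eq2 XD XZ ND Xg Xh N_max).
exact: (C_DW_eq4 N0 XD XZ ND NZ Xg Xh N_max).
Qed.
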